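(* Let $q$ be a prime power. Assume that $n$ is odd and $(n-1)\mid(q^2-1)$. Put $k=\lfloor\frac{n+q-1}{q+1}\rfloor$, $i_{\min}=\min\left(\lfloor\frac{n-q}{2}\rfloor-k,\;q-1\right)$ and $K=k+i_{\min}+1$. Assume further that $(n-1)\mid k(q+1)$. 1) If $(n-1)\nmid(K-1)(q+1)$ and $(n-1)\nmid(K-2)(q+1)$, then there exists a linear code $C$ with parameters $[n+2,K,n+2-K]_{q^2}$ with $\dim(\mathrm{Hull}_H(C))=K-\sharp\Delta_K-2$. 2) If $(n-1)\nmid(K-1)(q+1)$ and $(n-1)\mid(K-2)(q+1)$, then there exists a linear code $C$ with parameters $[n+2,K,n+2-K]_{q^2}$ with $\dim(\mathrm{Hull}_H(C))=K-\sharp\Delta_K-1$. 3) If $(n-1)\mid(K-1)(q+1)$ and $(n-1)\nmid(K-2)(q+1)$, then there exists a linear code $C$ with parameters $[n+2,K,n+2-K]_{q^2}$ with $\dim(\mathrm{Hull}_H(C))=K-\sharp\Delta_K-1$. 4) If $(n-1)\mid(K-1)(q+1)$ and $(n-1)\mid(K-2)(q+1)$, then there exists a linear code $C$ with parameters $[n+2,K,n+2-K]_{q^2}$ with $\dim(\mathrm{Hull}_H(C))=K-\sharp\Delta_K$.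
   Context: An $[n,k,d]_{q^2}$ code is a linear code over $\mathbb{F}_{q^2}$ of length $n$, dimension $k$ and minimum Hamming distance $d$. The Hermitian inner product on $\mathbb{F}_{q^2}^n$ is $\langle x,y\rangle_H=\sum_i x_iy_i^q$, $C^{\perp_H}$ is the dual of $C$ with respect to it, and $\mathrm{Hull}_H(C)=C\cap C^{\perp_H}$. Definition of $\Delta_m$: let $\alpha_1,\dots,\alpha_{n-1}$ be the $n-1$ distinct elements of $\mathbb{F}_{q^2}$ with $\alpha_i^{n-1}=1$, let $\alpha_n=0$, put $u_i=\prod_{j\ne i}(\alpha_i-\alpha_j)^{-1}$ for $1\le i\le n$ (these lie in $\mathbb{F}_q^*$), and choose $v_i\in\mathbb{F}_{q^2}^*$ with $v_i^{q+1}=u_i$. For $j\ge0$ put $\delta_j=\sum_{l=1}^n v_l^{q+1}\alpha_l^{j(q+1)}$ (with $0^0=1$); this is the Hermitian norm $\langle g_{j+1},g_{j+1}\rangle_H$ of the row $g_{j+1}=(v_1\alpha_1^{j},\dots,v_n\alpha_n^{j})$. For $m\ge1$, $\Delta_m=\{j:0\le j\le m-1,\ \delta_j\ne0\}$, and $\sharp\Delta_m$ is its cardinality.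
   Formalization: The assumption K ≥ 1 is added: the given formula yields K ≤ 0 for some admissible q and n (q = 7, n = 3 gives K = −1), where no [n+2, K, n+2−K] code exists. *)

(* Defs.v *)
From HB Require Import structures.
From mathcomp Require Import all_boot all_order all_algebra all_field.
Set Implicit Arguments. Unset Strict Implicit. Unset Printing Implicit Defensive.
Import Order.TTheory GRing.Theory Num.Theory.
Local Open Scope ring_scope.

(* A linear code of length n over F is a subspace of 'rV[F]_n. *)

Definition hdist (F : finFieldType) (n : nat) (x y : 'rV[F]_n) : nat :=
  #|[set i | x 0 i != y 0 i]|.

(* Only codes with at least two codewords have a minimum distance. *)
Definition min_distance (F : finFieldType) (n : nat)
    (C : {vspace 'rV[F]_n}) (d : nat) : Prop :=
  (exists x y, [/\ x \in C, y \in C, x != y & hdist x y = d]) /\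
  (forall x y, x \in C -> y \in C -> x != y -> (d <= hdist x y)%N).

(* C has parameters [n, k, d], n being the length in the type of C. *)
Definition code_params (F : finFieldType) (n : nat)
    (C : {vspace 'rV[F]_n}) (k d : nat) : Prop :=
  \dim C = k /\ min_distance C d.

(* Conjugate-linear in y when #|F| = q ^ 2. *)
Definition herm (F : finFieldType) (q n : nat) (x y : 'rV[F]_n) : F :=
  \sum_i x 0 i * y 0 i ^+ q.

(* The vectors orthogonal to C already form a subspace, so the span adds
   nothing: see mem_herm_dual. *)
Definition herm_dual (F : finFieldType) (q n : nat)
    (C : {vspace 'rV[F]_n}) : {vspace 'rV[F]_n} :=
  <<enum [set x : 'rV[F]_n | [forall (y | y \in C), (herm q x y == 0)%R]]>>%VS.

Lemma mem_herm_dual (F : finFieldType) (q n : nat)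
    (C : {vspace 'rV[F]_n}) (x : 'rV[F]_n) :
  reflect (forall y, y \in C -> herm q x y = 0) (x \in herm_dual q C).
Proof.
apply: (iffP idP) => [/coord_span-> y yC|x_orth]; last first.
  apply: memv_span; rewrite mem_enum inE.
  by apply/forall_inP => y yC; rewrite x_orth.
rewrite /herm.
under eq_bigr => j _ do rewrite summxE mulr_suml.
rewrite exchange_big big1 //= => i _.
under eq_bigr => j _ do rewrite mxE -mulrA.
rewrite -mulr_sumr.
set w := nth _ _ _.
have : w \in enum [set x : 'rV[F]_n | [forall (y | y \in C), (herm q x y == 0)%R]].
  by rewrite mem_nth // -cardE.
rewrite mem_enum inE => /forall_inP /(_ y yC) /eqP.
by rewrite /herm => ->; rewrite mulr0.
Qed.

Definition herm_hull (F : finFieldType) (q n : nat)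
    (C : {vspace 'rV[F]_n}) : {vspace 'rV[F]_n} :=
  (C :&: herm_dual q C)%VS.

(* Indices run from 0, so the point alpha_n = 0 is the one of index n.-1. *)
Definition roots_and_zero (F : finFieldType) (n : nat)
    (alpha : 'I_n -> F) : Prop :=
  [/\ injective alpha,
      forall i : 'I_n, (i < n.-1)%N -> alpha i ^+ n.-1 = 1
    & forall i : 'I_n, i = n.-1 :> nat -> alpha i = 0].

Definition lagrange_weight (F : finFieldType) (n : nat)
    (alpha : 'I_n -> F) (i : 'I_n) : F :=
  \prod_(j < n | j != i) (alpha i - alpha j)^-1.

Definition norm_roots (F : finFieldType) (q n : nat)
    (alpha v : 'I_n -> F) : Prop :=
  forall i, v i != 0 /\ v i ^+ q.+1 = lagrange_weight alpha i.

Definition delta (F : finFieldType) (q n : nat)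
    (alpha v : 'I_n -> F) (j : nat) : F :=
  \sum_(l < n) v l ^+ q.+1 * alpha l ^+ (j * q.+1).

Definition Delta (F : finFieldType) (q n : nat)
    (alpha v : 'I_n -> F) (m : nat) : {set 'I_m} :=
  [set j : 'I_m | delta q alpha v j != 0].

(* Main.v *)
Require Import Defs.
From HB Require Import structures.
From mathcomp Require Import all_boot all_order all_algebra all_field.
From mathcomp Require Import zify ring.
Set Implicit Arguments. Unset Strict Implicit. Unset Printing Implicit Defensive.
Import Order.TTheory GRing.Theory Num.Theory.
Local Open Scope ring_scope.

(* The Lagrange weights at the n - 1 nonzero points are all 1/(n-1), so
   sum_i u_i alpha_i^t is 1 if t > 0 and (n-1) | t, and 0 otherwise. The
   divisibility hypotheses force n - 1 = k(q+1) with k | q - 1, apart from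
   q = n = 3; since K <= k + q, the rows g_1, ..., g_K are then pairwise
   Hermitian orthogonal, with norms delta_j in {0, 1}.
   Append two columns: one whose only nonzero entry is a 1 in the last row, and,
   when (n-1) does not divide (K-2)(q+1), a copy of the coordinate of
   alpha_n = 0 scaled to be 1 in the first row. The Gram matrix stays diagonal,
   its last entry becomes nonzero (q is odd) and the first one changes from 0 to
   1 exactly when the copied column is present. The hull has the dimension of
   the kernel of this diagonal matrix. A polynomial of degree K - 1 with K - 1
   roots among the points, 0 included, gives a codeword of weight n + 2 - K. *)

(** * Arithmetic of n, q, k and K *)

(** Since k(q + 1) is a multiple of n - 1 lying between n - 1 and n + q - 1, it equals n - 1 as soon
    as n > q + 1. Otherwise k = 1, and K > 0 forces n >= q, which with 2(n - 1) <= q + 1 leaves only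
    q = n = 3. *)
Lemma length_cases (n q k K : nat) (imin : int) :
  odd n -> (n - 1 %| q ^ 2 - 1)%N -> (1 < q)%N ->
  k = ((n + q - 1) %/ (q + 1))%N ->
  imin = Num.min (((n%:Z - q%:Z) %/ 2)%Z - k%:Z) (q%:Z - 1) ->
  K%:Z = k%:Z + imin + 1 -> (0 < K)%N -> (n - 1 %| k * (q + 1))%N ->
  [/\ q = 3, n = 3 & K = 1]%N \/
  [/\ (n - 1 = k * (q + 1))%N, (k %| q - 1)%N & (1 < K <= minn n (k + q))%N].
Proof.
move=> n_odd n_dvd q_gt1 k_def -> K_def K_gt0 /dvdnP[s sE].
have n_gt2 : (2 < n)%N.
  case: n n_odd n_dvd {k_def K_def sE} => [|[|[|n]]] //= _.
  by rewrite dvd0n subn_eq0 leqNgt -{1}(exp1n 2) ltn_exp2r // q_gt1.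
(* Here K = min(floor((n - q) / 2) + 1, k + q), restated without floor or minimum for linear
   arithmetic. *)
have [K_le K_half K_cases] : [/\ (K <= k + q)%N, (2 * K <= n + 2 - q)%N
    & K = (k + q)%N \/ (n < 2 * K + q)%N].
  have rE := divz_eq (n%:Z - q%:Z) 2.
  have := ltz_pmod (n%:Z - q%:Z) (isT : 0 < 2 :> int).
  have := modz_ge0 (n%:Z - q%:Z) (isT : 2 != 0 :> int).
  move: (modz _ _) (divz _ _) rE K_def => r h; rewrite minEle.
  by move: q_gt1 K_gt0; clear; case: (leP (h - k%:Z)) => *; split; lia.
have k_dvd_q : (n - 1 = k * (q + 1) -> k %| q - 1)%N.
  move=> nE; move: n_dvd; rewrite nE -[X in (_ %| _ - X)%N](exp1n 2) subn_sqr.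
  by rewrite dvdn_pmul2r // addn1.
have kq_le : (k * (q + 1) <= n + q - 1)%N by rewrite k_def leq_divM.
have kq_ge : (n - 1 <= k * (q + 1))%N.
  have := ltn_ceil (n + q - 1) (isT : 0 < q.+1)%N.
  by rewrite -[q.+1]addn1 -k_def mulSn; move: n_gt2 q_gt1; clear; lia.
clear k_def K_def n_dvd.
have [n_le|n_gt] := leqP n (q + 1); [left|right].
  have k1 : k = 1%N.
    have : (k * (q + 1) < 2 * (q + 1))%N.
      by apply: leq_ltn_trans kq_le _; move: n_le n_gt2; clear; lia.
    rewrite ltn_mul2r => /andP[_ k_lt2].
    case: k k_lt2 kq_ge {sE K_le K_cases kq_le k_dvd_q} => [|[|k]] //.
    by move: n_gt2; clear; lia.
  rewrite k1 mul1n in sE.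
  move: sE n_odd n_gt2 n_le K_half K_cases K_gt0 k1; clear=> sE *.
  have : (2 * (n - 1) <= q + 1)%N.
    rewrite sE leq_mul2r.
    by case: s sE => [|[|s]] //; rewrite ?mul1n ?orbT //; lia.
  by move: sE => _; split; lia.
have nE : (n - 1 = k * (q + 1))%N.
  apply/eqP; rewrite eqn_leq kq_ge sE -{2}[(n - 1)%N]mul1n leq_mul2r orbC -ltnS.
  have : (s * (n - 1) < 2 * (n - 1))%N.
    by rewrite -sE; apply: leq_ltn_trans kq_le _; move: n_gt; clear; lia.
  by rewrite ltn_mul2r => /andP[_ ->].
split; [by []|exact: k_dvd_q|].
have k_gt0 : (0 < k)%N.
  case: k nE {sE K_le K_cases kq_le kq_ge k_dvd_q} => //.
  by move: n_gt2; clear; lia.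
have : (k + q <= k * (q + 1))%N.
  by rewrite mulnDr muln1 addnC leq_add2r leq_pmull.
by move: K_gt0 K_cases K_le K_half nE k_gt0 n_gt q_gt1; clear; lia.
Qed.

(** Modulo q + 1 one has q = -1, so j and l are congruent; both are below 2(q + 1), so if distinct
    they differ by exactly q + 1. Cancelling q + 1 and using that k divides q - 1, k divides min(j,
    l) + 1, a positive number below k. *)
Lemma gram_offdiag (k q j l : nat) :
  (1 < q)%N -> (k %| q - 1)%N -> (j < k + q)%N -> (l < k + q)%N ->
  (k * (q + 1) %| j + l * q)%N -> j = l.
Proof.
move=> q_gt1 kq jK lK dv.
have k_gt0 : (0 < k)%N by case: k kq {jK lK dv} => //; rewrite dvd0n; lia.
have k_le : (k <= q - 1)%N by apply: dvdn_leq => //; lia.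
have q1_gt0 : (0 < q + 1)%N by lia.
have q1dv : (q + 1 %| j + l * q)%N by apply: dvdn_trans dv; rewrite dvdn_mull.
have no_mult m : (0 < m < k)%N -> (k %| m)%N -> False.
  by case/andP=> m0 mk /(dvdn_leq m0); lia.
case: (ltngtP j l) => // jl; exfalso.
  have [d lE] : exists d, (l = j + d)%N.
    by exists (l - j)%N; rewrite subnKC // ltnW.
  have jlE : (j + l * q = d * q + j * (q + 1))%N.
    by rewrite lE mulnDl mulnDr muln1; clear; lia.
  have : (q + 1 %| d)%N.
    move: q1dv; rewrite jlE (dvdn_addl _ (dvdn_mull _ (dvdnn _))) Gauss_dvdl //.
    by rewrite addn1 coprimeSn.
  case/dvdnP=> t tE; case: t tE => [|[|t]] tE.
  - by move: jl lE tE; clear; lia.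
  - have {}jlE : (j + l * q = (j + q) * (q + 1))%N.
      by rewrite jlE tE mul1n mulnC -mulnDl addnC.
    move: dv; rewrite jlE dvdn_pmul2r // => dv.
    apply: (no_mult (j + 1)%N); first by move: lE tE lK k_le q_gt1; clear; lia.
    rewrite -(dvdn_addl _ kq); have -> : (j + 1 + (q - 1) = j + q)%N by lia.
    by [].
  - by rewrite !mulSn in tE; move: lE tE lK k_le q_gt1; clear; lia.
have [d jE] : exists d, (j = l + d)%N.
  by exists (j - l)%N; rewrite subnKC // ltnW.
have jlE : (j + l * q = d + l * (q + 1))%N.
  by rewrite jE mulnDr muln1; clear; lia.
have : (q + 1 %| d)%N.
  by move: q1dv; rewrite jlE (dvdn_addl _ (dvdn_mull _ (dvdnn _))).
case/dvdnP=> t tE; case: t tE => [|[|t]] tE.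
- by move: jl jE tE; clear; lia.
- have {}jlE : (j + l * q = (l + 1) * (q + 1))%N.
    by rewrite jlE tE -mulnDl addnC.
  move: dv; rewrite jlE dvdn_pmul2r // => dv.
  by apply: (no_mult (l + 1)%N) => //; move: jE tE jK k_le q_gt1; clear; lia.
- by rewrite !mulSn in tE; move: jE tE jK k_le q_gt1; clear; lia.
Qed.

(** * Row spaces and the hull of a code with orthogonal generators *)

Definition rowspace (F : fieldType) (m n : nat) (A : 'M[F]_(m, n)) :
    {vspace 'rV[F]_n} := limg (linfun (mulmxr A : 'rV[F]_m -> 'rV[F]_n)).

Lemma rowspaceP (F : fieldType) (m n : nat) (A : 'M[F]_(m, n)) (x : 'rV[F]_n) :
  reflect (exists u, x = u *m A) (x \in rowspace A).
Proof.
apply: (iffP memv_imgP) => [[u _ ->]|[u ->]]; exists u; rewrite ?memvf //.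
  by rewrite lfunE.
by rewrite lfunE.
Qed.

Lemma dim_rowspace (F : fieldType) (m n : nat) (A : 'M[F]_(m, n)) :
  row_free A -> \dim (rowspace A) = m.
Proof.
move=> A_free; rewrite /rowspace; set f := linfun _.
have f0 : lker f == 0%VS.
  by apply/lker0P=> u w; rewrite !lfunE /=; exact: row_free_inj.
rewrite limg_dim_eq; last by rewrite (eqP f0) capv0.
by rewrite dimvf [LHS]dim_matrix; exact: mul1n.
Qed.

Lemma row_free_rowsub (F : fieldType) (m m' n : nat) (f : 'I_m' -> 'I_m)
    (A : 'M[F]_(m, n)) :
  injective f -> row_free A -> row_free (rowsub f A).
Proof.
move=> f_inj A_free; rewrite /row_free -[A]mul1mx -mul_rowsub_mx mxrankMfree //.
(* As [f] is injective, the transposed selection matrix is a right inverse. *)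
rewrite -/(row_free _); apply/row_freeP; exists (rowsub f 1%:M)^T.
apply/matrixP=> i j; rewrite !mxE (bigD1 (f i)) //= big1 => [|l lfi].
  by rewrite !mxE eqxx mul1r addr0 (inj_eq f_inj) eq_sym.
by rewrite !mxE eq_sym (negPf lfi) mul0r.
Qed.

(** The condition on [q] encodes a power of the characteristic, so x -> x^q is additive; it also
    gives q > 0, hence 0^q = 0. *)
Lemma expr_sum_pchar (R : comNzRingType) (q : nat) (I : Type) (r : seq I)
    (f : I -> R) :
  [pchar R].-nat q -> (\sum_(i <- r) f i) ^+ q = \sum_(i <- r) f i ^+ q.
Proof.
move=> q_nat; apply: (big_morph (fun x => x ^+ q)) => [x y|].
  exact: exprDn_pchar.
by rewrite expr0n gtn_eqF //; case/andP: q_nat.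
Qed.

Lemma herm_mulmx (F : finFieldType) (q m n : nat) (A : 'M[F]_(m, n))
    (u w : 'rV[F]_m) :
  [pchar F].-nat q ->
  herm q (u *m A) (w *m A) =
  \sum_j \sum_l u 0 j * w 0 l ^+ q * herm q (row j A) (row l A).
Proof.
move=> q_nat; rewrite /herm.
transitivity (\sum_i \sum_j \sum_l (u 0 j * w 0 l ^+ q * (A j i * A l i ^+ q))).
  apply: eq_bigr => i _; rewrite !mxE expr_sum_pchar // big_distrl.
  apply: eq_bigr => j _; rewrite big_distrr; apply: eq_bigr => l _ /=.
  by rewrite exprMn mulrACA.
rewrite exchange_big; apply: eq_bigr => j _.
rewrite exchange_big; apply: eq_bigr => l _ /=.
by rewrite big_distrr; apply: eq_bigr => i _; rewrite !mxE.
Qed.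

(** Pairing [u *m A] with row [j] yields u_j d_j, so the hull is spanned by the rows with d_j = 0,
    which stay independent. *)
Lemma dim_hull_orthogonal_rows (F : finFieldType) (q m n : nat)
    (A : 'M[F]_(m, n)) (d : 'I_m -> F) :
  [pchar F].-nat q -> row_free A ->
  (forall j l, herm q (row j A) (row l A) = d j *+ (j == l)) ->
  \dim (herm_hull q (rowspace A)) = #|[set j | d j == 0]|.
Proof.
move=> q_nat A_free A_orth; set J := [set j | _].
pose f : 'I_#|J| -> 'I_m := enum_val.
have fJ s : d (f s) = 0.
  by have := enum_valP s; rewrite inE => /eqP.
have hermE u w : herm q (u *m A) (w *m A) = \sum_j u 0 j * w 0 j ^+ q * d j.
  rewrite herm_mulmx //; apply: eq_bigr => j _.
  rewrite (bigD1 j) //= A_orth eqxx mulr1n big1 ?addr0 // => l lj.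
  by rewrite A_orth eq_sym (negPf lj) mulr0n mulr0.
rewrite -[RHS](dim_rowspace (row_free_rowsub (@enum_val_inj _ (mem J)) A_free)).
congr (\dim _); apply/vspaceP => x; apply/idP/idP.
  case/memv_capP => /rowspaceP[u ->] /mem_herm_dual u_orth.
  have u0 j : d j != 0 -> u 0 j = 0.
    (* Orthogonality to row [j] of [A] isolates the coordinate u_j. *)
    move=> dj; have /u_orth : delta_mx 0 j *m A \in rowspace A.
      by apply/rowspaceP; exists (delta_mx 0 j).
    rewrite hermE (bigD1 j) //= !mxE !eqxx expr1n mulr1 big1 => [|l lj].
      by move/eqP; rewrite addr0 mulf_eq0 (negPf dj) orbF => /eqP.
    rewrite !mxE eqxx (negPf lj) /= expr0n gtn_eqF /= ?mulr0 ?mul0r //.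
    by case/andP: q_nat.
  apply/rowspaceP; exists (\row_s u 0 (f s)).
  apply/rowP => i; rewrite !mxE (bigID (mem J)) /=.
  rewrite [X in _ + X]big1 ?addr0; last first.
    by move=> j; rewrite inE => /u0 ->; rewrite mul0r.
  by rewrite big_enum_val /=; apply: eq_bigr => s _; rewrite !mxE.
case/rowspaceP => w ->; have rE : rowsub f A = rowsub f 1%:M *m A.
  by rewrite mul_rowsub_mx mul1mx.
rewrite rE mulmxA; apply/memv_capP; split.
  by apply/rowspaceP; exists (w *m rowsub f 1%:M).
apply/mem_herm_dual => y /rowspaceP[u ->]; rewrite hermE big1 // => j _.
have [->|dj] := eqVneq (d j) 0; first by rewrite mulr0.
rewrite !mxE big1 ?mul0r // => s _; rewrite !mxE.
case: (eqVneq (f s) j) dj => [<-|_ _]; first by rewrite fJ eqxx.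
by rewrite mulr0.
Qed.

(** * Lagrange weights and their power sums *)

Lemma prod_points (F : finFieldType) (n : nat) (alpha : 'I_n -> F) :
  (1 < n)%N -> roots_and_zero alpha ->
  \prod_i ('X - (alpha i)%:P) = 'X^n - 'X.
Proof.
move=> n_gt1 [alpha_inj alpha_root alpha0].
pose rs := [seq alpha i | i <- enum 'I_n].
have rs_size : size rs = n by rewrite size_map size_enum_ord.
have p_size : size ('X^n - 'X : {poly F}) = n.+1.
  by rewrite size_polyDl ?size_polyXn // size_polyN size_polyX.
have p_lead : lead_coef ('X^n - 'X : {poly F}) = 1.
  by rewrite lead_coefDl ?lead_coefXn // size_polyN size_polyX size_polyXn.
rewrite [RHS](@all_roots_prod_XsubC _ _ rs) ?rs_size ?p_size ?p_lead //.
- by rewrite scale1r big_map big_enum.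
- apply/allP => _ /mapP[i _ ->]; rewrite rootE !(hornerE, hornerXn).
  have nE : n = n.-1.+1 by rewrite prednK // ltnW.
  have [in1|in1] := ltnP i n.-1.
    by rewrite [X in _ ^+ X]nE exprS alpha_root // mulr1 subrr.
  rewrite alpha0 ?expr0n ?gtn_eqF ?subr0 // 1?ltnW //.
  by apply/eqP; rewrite eqn_leq in1 -ltnS -nE ltn_ord.
by rewrite uniq_rootsE map_inj_uniq ?enum_uniq.
Qed.

(** With P the product of the X - alpha_j, the weight is 1 / P'(alpha_i), and P = X^n - X. *)
Lemma lagrange_weightE (F : finFieldType) (n : nat) (alpha : 'I_n -> F) i :
  (1 < n)%N -> roots_and_zero alpha ->
  lagrange_weight alpha i = (n%:R * alpha i ^+ n.-1 - 1)^-1.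
Proof.
move=> n_gt1 alphaP; rewrite /lagrange_weight prodfV; congr (_^-1).
have := congr1 (fun p => p^`().[alpha i]) (prod_points n_gt1 alphaP).
rewrite (bigD1 i) //= derivM derivXsubC mul1r !hornerE subrr mul0r addr0.
rewrite derivB derivXn derivX !(hornerE, hornerMn, hornerXn) mulr_natl => <-.
by rewrite horner_prod; apply: eq_bigr => j _; rewrite !hornerE.
Qed.

Lemma prim_root_points (F : finFieldType) (n : nat) (alpha : 'I_n -> F) :
  (1 < n)%N -> roots_and_zero alpha -> exists z : F, n.-1.-primitive_root z.
Proof.
move=> n_gt1 [alpha_inj alpha_root _].
pose rs := [seq alpha i | i <- [seq i : 'I_n <- enum 'I_n | (i < n.-1)%N]].
have rs_size : size rs = n.-1.
  rewrite size_map -(size_map (val : 'I_n -> nat)).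
  rewrite -(filter_map _ (fun i => i < n.-1)%N) val_enum_ord.
  have nE : n = (n.-1 + 1)%N by rewrite addn1 prednK // ltnW.
  rewrite [X in iota _ X]nE iotaD filter_cat /= add0n ltnn cats0.
  rewrite (@eq_in_filter _ _ predT) ?filter_predT ?size_iota // => i.
  by rewrite mem_iota add0n.
suff /hasP[z _ zP] : has n.-1.-primitive_root rs by exists z.
apply: cyclic.has_prim_root; rewrite ?rs_size //.
- by rewrite -ltnS prednK // ltnW.
- apply/allP => x /mapP[i]; rewrite mem_filter => /andP[i_lt _] ->.
  by apply/unity_rootP; apply: alpha_root.
- by rewrite map_inj_uniq // filter_uniq ?enum_uniq.
Qed.

(** If n - 1 does not divide t, rotating the points by a primitive root [z] multiplies the sum by
    z^t, which is not 1. Otherwise the nonzero points contribute 1 in total, and the point 0, of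
    weight -1, cancels this exactly when t = 0, where 0^0 = 1. *)
Lemma lagrange_power_sum (F : finFieldType) (n t : nat) (alpha : 'I_n -> F) :
  (1 < n)%N -> roots_and_zero alpha ->
  \sum_i lagrange_weight alpha i * alpha i ^+ t =
  ((0 < t) && (n.-1 %| t))%N%:R.
Proof.
move=> n_gt1 alphaP; have [z zP] := prim_root_points n_gt1 alphaP.
have z0 : z != 0 by rewrite (prim_root_eq0 zP) -lt0n -ltnS prednK // ltnW.
have nE : n = n.-1.+1 by rewrite prednK // ltnW.
have [alpha_inj alpha_root alpha0] := alphaP.
have [n_dvd|n_ndvd] := boolP (n.-1 %| t)%N; last first.
  rewrite andbF; pose g (x : F) := (n%:R * x ^+ n.-1 - 1)^-1 * x ^+ t.
  have memE x : (x \in [set alpha i | i in setT]) = (x ^+ n == x).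
    have := congr1 (fun p => p.[x]) (prod_points n_gt1 alphaP).
    rewrite -subr_eq0.
    rewrite !(hornerE, hornerXn) => <-; rewrite horner_prod prodf_seq_eq0.
    apply/imsetP/hasP => [[i _ ->]|[i _]].
      by exists i; rewrite ?mem_index_enum //= !hornerE subrr.
    by rewrite /= !hornerE subr_eq0 => /eqP ->; exists i.
  have -> : \sum_i lagrange_weight alpha i * alpha i ^+ t =
      \sum_(x | x ^+ n == x) g x.
    rewrite -(eq_bigl _ _ memE) big_imset /=; last first.
      by move=> i j _ _; exact: alpha_inj.
    by apply: eq_big => [i|i _]; rewrite ?inE // lagrange_weightE.
  (* Multiplication by z preserves the set of points and the weights. *)
  have : \sum_(x | x ^+ n == x) g x = z ^+ t * \sum_(x | x ^+ n == x) g x.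
    rewrite [LHS](reindex_inj (mulfI z0)) big_distrr /=.
    apply: eq_big => [x|x _].
      rewrite exprMn {1}nE exprS (prim_expr_order zP) mulr1.
      by rewrite (inj_eq (mulfI z0)).
    by rewrite /g !exprMn (prim_expr_order zP) mul1r mulrCA.
  move/eqP; rewrite -subr_eq0 -{1}[X in X - _]mul1r -mulrBl mulf_eq0 subr_eq0.
  by rewrite eq_sym -(prim_order_dvd zP) (negPf n_ndvd) => /eqP.
have last_lt : (n.-1 < n)%N by rewrite {2}nE.
pose o := Ordinal last_lt.
have powE i : i != o -> alpha i ^+ n.-1 = 1.
  by move=> io; apply: alpha_root; rewrite ltn_neqAle io -ltnS -nE ltn_ord.
have n1_0 : n.-1%:R != 0 :> F := prim_root_natf_neq0 zP.
have n1_gt0 : (0 < n.-1)%N by rewrite -ltnS -nE.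
have [s tE] := dvdnP n_dvd.
rewrite (bigD1 o) //= (eq_bigr (fun=> n.-1%:R^-1)) => [|i io].
  rewrite sumr_const cardC1 card_ord -[_ *+ _]mulr_natr mulVf //.
  rewrite lagrange_weightE // alpha0 // !expr0n (gtn_eqF n1_gt0) mulr0 sub0r.
  rewrite invrN invr1 andbT.
  by case: t {n_dvd tE} => [|t] /=; rewrite ?mulr1 ?addNr ?mulr0 ?add0r.
rewrite lagrange_weightE // powE // mulr1 tE mulnC exprM powE // expr1n mulr1.
by rewrite {1}nE mulrSr addrK.
Qed.

(** The order n - 1 of a primitive root is nonzero in [F], and 2 divides it. *)
Lemma natr2_neq0 (F : finFieldType) (n : nat) (alpha : 'I_n -> F) :
  odd n -> (1 < n)%N -> roots_and_zero alpha -> 2%:R != 0 :> F.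
Proof.
move=> n_odd n_gt1 alphaP; have [z zP] := prim_root_points n_gt1 alphaP.
apply: (prim_root_dvd_eq0 zP); rewrite dvdn2.
by case: n n_odd {n_gt1 alpha alphaP zP}.
Qed.

(** * The extended code and its parameters *)

Lemma min_distance_linear (F : finFieldType) (n d : nat)
    (C : {vspace 'rV[F]_n}) (x : 'rV[F]_n) :
  x \in C -> x != 0 -> (hdist x 0 <= d)%N ->
  (forall y, y \in C -> y != 0 -> (d <= hdist y 0)%N) -> min_distance C d.
Proof.
move=> xC x0 x_le ge_d; split.
  exists x, 0; split; rewrite ?mem0v //.
  by apply/eqP; rewrite eqn_leq x_le ge_d.
move=> y z yC zC yz; have -> : hdist y z = hdist (y - z) 0.
  by apply: eq_card => i; rewrite !inE !mxE subr_eq0.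
by rewrite ge_d ?memvB // subr_eq0.
Qed.

(** A message [u] is evaluated as the polynomial [rVpoly u]; the first appended column reads its
    coefficient of X^(K-1), the point at infinity, and the second its constant term. When [b] is
    false the second column is kept as zeros, so the length remains n + 2. *)
Definition extended_grs (F : finFieldType) (n K : nat) (alpha v : 'I_n -> F)
    (b : bool) : 'M[F]_(K, n + 2) :=
  row_mx (\matrix_(j, i) (v i * alpha i ^+ j))
    (\matrix_(j, s) (if s == 0 then j.+1 == K else b && (j == 0 :> nat)%N)%:R).

Lemma horner_rVpoly_sum (F : fieldType) (K : nat) (u : 'rV[F]_K) (x : F) :
  (rVpoly u).[x] = \sum_j u 0 j * x ^+ j.
Proof.
by rewrite horner_poly; apply: eq_bigr => j _; rewrite valK.
Qed.

Lemma extended_grs_weight (F : finFieldType) (n K : nat) (alpha v : 'I_n -> F)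
    (b : bool) (u : 'rV[F]_K) :
  (0 < K)%N -> (forall i, v i != 0) ->
  hdist (u *m extended_grs K alpha v b) 0 =
  (\sum_i ((rVpoly u).[alpha i] != 0)%R + ((rVpoly u)`_K.-1 != 0)%R
   + (b && ((rVpoly u)`_0 != 0)%R))%N.
Proof.
move=> K_gt0 v0.
rewrite /hdist -sum1dep_card big_mkcond big_split_ord /= -addnA.
congr (_ + _)%N.
  apply: eq_bigr => i _; rewrite mul_mx_row row_mxEl !mxE horner_rVpoly_sum.
  rewrite (eq_bigr (fun j : 'I_K => v i * (u 0 j * alpha i ^+ j))) => [|j _].
    by rewrite -big_distrr mulf_eq0 (negPf (v0 i)) /=; case: (_ == 0).
  by rewrite mxE mulrCA.
rewrite !big_ord_recl big_ord0 addn0 !mul_mx_row !row_mxEr !mxE.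
have ltKK : (K.-1 < K)%N by rewrite prednK.
congr (_ + _)%N.
  rewrite (coef_rVpoly_ord u (Ordinal ltKK)) (bigD1 (Ordinal ltKK)) //=.
  rewrite !mxE /= prednK // eqxx mulr1 big1 ?addr0 => [|j jK].
    by case: (_ != 0).
  rewrite !mxE /= -[K in _ == K]prednK // eqSS -[_ == K.-1]/(j == Ordinal ltKK).
  by rewrite (negPf jK) mulr0.
rewrite (coef_rVpoly_ord u (Ordinal K_gt0)) (bigD1 (Ordinal K_gt0)) //=.
rewrite !mxE /= andbT big1 ?addr0 => [|j jK].
  by case: b; rewrite ?mulr1 ?mulr0 ?eqxx //=; case: (_ != 0).
rewrite !mxE /= -[_ == 0%N]/(j == Ordinal K_gt0).
by rewrite (negPf jK) andbF mulr0.
Qed.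

Lemma count_roots_lt (F : fieldType) (n : nat) (alpha : 'I_n -> F)
    (f : {poly F}) :
  injective alpha -> f != 0 -> (\sum_i (f.[alpha i] == 0)%R < size f)%N.
Proof.
move=> alpha_inj f0.
have -> : (\sum_i (f.[alpha i] == 0)%R =
    size [seq alpha i | i <- [seq i <- enum 'I_n | (f.[alpha i] == 0)%R]])%N.
  rewrite size_map size_filter -sum1_count [RHS]big_mkcond [RHS]big_enum /=.
  by apply: eq_bigr => i _; case: (_ == 0).
apply: max_poly_roots f0 _ _.
  by apply/allP => x /mapP[i]; rewrite mem_filter => /andP[fi _] ->.
by rewrite map_inj_uniq // filter_uniq ?enum_uniq.
Qed.

(** A nonzero f has fewer than [size f] roots among the points, and [size f] drops below K when its
    coefficient of X^(K-1) is zero. The points and the first appended column thus already give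
    weight at least n + 2 - K, whatever [b] is. *)
Lemma extended_grs_weight_ge (F : finFieldType) (n K : nat)
    (alpha v : 'I_n -> F) (b : bool) (u : 'rV[F]_K) :
  (0 < K)%N -> injective alpha -> (forall i, v i != 0) -> u != 0 ->
  (n + 2 - K <= hdist (u *m extended_grs K alpha v b) 0)%N.
Proof.
move=> K_gt0 alpha_inj v0 u0; rewrite extended_grs_weight //.
set f := rVpoly u.
have f0 : f != 0.
  by apply: contra u0 => /eqP f0; rewrite -(rVpolyK u) -/f f0 raddf0.
have roots_lt := count_roots_lt alpha_inj f0.
have size_f : (size f + (f`_K.-1 == 0)%R <= K)%N.
  have : (size f <= K)%N by exact: size_poly.
  rewrite leq_eqVlt => /orP[/eqP fK|f_lt]; last first.
    by apply: leq_trans f_lt; rewrite -addn1 leq_add2l leq_b1.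
  by rewrite -{1}fK -lead_coefE lead_coef_eq0 (negPf f0) addn0 fK.
have nE : (n = \sum_i (f.[alpha i] != 0)%R + \sum_i (f.[alpha i] == 0)%R)%N.
  rewrite -big_split /= -[LHS]card_ord -sum1_card; apply: eq_bigr => i _.
  by case: (_ == 0).
move: roots_lt size_f nE; clear.
move: (\sum_i _)%N (\sum_i _)%N (size f) (_ && _) => r s d c.
by case: (f`_K.-1 == 0) => /=; lia.
Qed.

(** A nonzero message in the kernel would have weight 0, against the bound n + 2 - K > 0. *)
Lemma row_free_extended_grs (F : finFieldType) (n K : nat)
    (alpha v : 'I_n -> F) (b : bool) :
  (0 < K < n + 2)%N -> injective alpha -> (forall i, v i != 0) ->
  row_free (extended_grs K alpha v b).
Proof.
case/andP=> K_gt0 K_lt alpha_inj v0.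
rewrite -kermx_eq0; apply/eqP/row_matrixP=> i.
rewrite row0; apply/eqP; apply: contraT => u0.
have := extended_grs_weight_ge b K_gt0 alpha_inj v0 u0.
set G := extended_grs K alpha v b; have -> : row i (kermx G) *m G = 0.
  by apply/sub_kermxP; exact: row_sub.
have -> : hdist (0 : 'rV[F]_(n + 2)) 0 = 0%N.
  by apply: eq_card0 => j; rewrite inE eqxx.
by rewrite leqn0 subn_eq0 leqNgt K_lt.
Qed.

Lemma extended_grs_params (F : finFieldType) (n K : nat)
    (alpha v : 'I_n -> F) (b : bool) :
  (1 < K <= n)%N -> roots_and_zero alpha -> (forall i, v i != 0) ->
  code_params (rowspace (extended_grs K alpha v b)) K (n + 2 - K).
Proof.
case/andP=> K_gt1 K_le [alpha_inj _ alpha0] v0.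
have K_gt0 : (0 < K)%N by exact: ltnW.
have K_lt : (0 < K < n + 2)%N by rewrite K_gt0 addn2 !ltnS ltnW.
have n_gt0 : (0 < n)%N by exact: leq_trans K_le.
split; first by rewrite dim_rowspace ?row_free_extended_grs.
(* K - 1 of the points, among them 0, are the roots of f. *)
pose m := (n.+1 - K)%N.
pose f := \prod_(i <- drop m (enum 'I_n)) ('X - (alpha i)%:P).
have f_size : size f = K.
  rewrite size_prod_XsubC size_drop size_enum_ord /m.
  by move: K_le K_gt0; clear; lia.
have f_root (i : 'I_n) : (m <= i)%N -> f.[alpha i] = 0.
  move=> mi; apply/eqP; rewrite -[_ == 0]/(root f (alpha i)).
  have -> : f =
      \prod_(x <- [seq alpha i | i <- drop m (enum 'I_n)]) ('X - x%:P).
    by rewrite big_map.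
  rewrite root_prod_XsubC map_f //.
  rewrite -(nth_ord_enum i i) -(subnKC mi) -nth_drop mem_nth //.
  by rewrite size_drop size_enum_ord ltn_sub2r // (leq_ltn_trans mi).
have fK : rVpoly (poly_rV f : 'rV_K) = f by rewrite poly_rV_K ?f_size.
have f0 : poly_rV f != 0 :> 'rV_K.
  rewrite -(inj_eq (can_inj rVpolyK)) raddf0 fK.
  by rewrite -size_poly_eq0 f_size gtn_eqF.
(* K > 1 puts the index n - 1 of the point 0 among the roots. *)
have f_at0 : f`_0 = 0.
  have last_lt : (n.-1 < n)%N by rewrite prednK.
  rewrite -horner_coef0 -[X in f.[X]](alpha0 (Ordinal last_lt)) // f_root //=.
  by rewrite /m; move: K_gt1; clear; lia.
apply: (@min_distance_linear _ _ _ _ (poly_rV f *m extended_grs K alpha v b)).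
- by apply/rowspaceP; exists (poly_rV f).
- by rewrite mulmx_free_eq0 ?row_free_extended_grs.
(* The second appended coordinate vanishes with f(0), leaving at most the m points not chosen as
   roots and the leading coefficient. *)
- rewrite extended_grs_weight // fK f_at0 eqxx andbF addn0.
  have -> : (n + 2 - K = m + 1)%N by rewrite /m; move: K_le; clear; lia.
  apply: leq_add; last exact: leq_b1.
  have m_le : (m <= n)%N by rewrite /m; move: K_gt0; clear; lia.
  rewrite -[m in (_ <= m)%N]card_ord -sum1_card.
  rewrite -(@big_ord_narrow _ _ _ m n (fun=> 1%N) m_le) [leqRHS]big_mkcond /=.
  apply: leq_sum => i _; case: ltnP => [_|/f_root ->]; first exact: leq_b1.
  by rewrite eqxx.
move=> _ /rowspaceP[u ->] u0; apply: extended_grs_weight_ge => //.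
by apply: contraNneq u0 => ->; rewrite mul0mx.
Qed.

(** * Gram matrix and hull of the extended code *)

Lemma deltaE (F : finFieldType) (q n j : nat) (alpha v : 'I_n -> F) :
  (1 < n)%N -> roots_and_zero alpha -> norm_roots q alpha v ->
  delta q alpha v j = ((0 < j) && (n.-1 %| j * q.+1))%N%:R.
Proof.
move=> n_gt1 alphaP vP; rewrite /delta.
under eq_bigr => i _ do rewrite (vP i).2.
by rewrite lagrange_power_sum // muln_gt0 andbT.
Qed.

(** Over the points this is the power sum of exponent j + lq, which vanishes for j != l by the
    divisibility hypothesis and is delta_j for j = l. Each appended column has at most one nonzero
    entry, so it only touches the diagonal. *)
Lemma extended_grs_gram (F : finFieldType) (q n K : nat)
    (alpha v : 'I_n -> F) (b : bool) (j l : 'I_K) :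
  (1 < n)%N -> (0 < q)%N -> roots_and_zero alpha -> norm_roots q alpha v ->
  (n.-1 %| j + l * q -> j = l)%N ->
  herm q (row j (extended_grs K alpha v b)) (row l (extended_grs K alpha v b)) =
  (delta q alpha v j + (j.+1 == K)%:R + (b && (j == 0 :> nat)%N)%:R)
    *+ (j == l).
Proof.
move=> n_gt1 q_gt0 alphaP vP jl; rewrite /herm big_split_ord /=.
have -> : \sum_(i < n) row j (extended_grs K alpha v b) 0 (lshift 2 i) *
    row l (extended_grs K alpha v b) 0 (lshift 2 i) ^+ q =
    delta q alpha v j *+ (j == l).
  transitivity (\sum_i lagrange_weight alpha i * alpha i ^+ (j + l * q)).
    apply: eq_bigr => i _; rewrite -(vP i).2 ![row _ _ _ _]mxE !row_mxEl !mxE.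
    by rewrite exprMn -exprM exprD exprS; ring.
  rewrite lagrange_power_sum // deltaE //.
  have [->|/eqP jl_neq] := eqVneq j l.
    by rewrite mulnS mulr1n addn_gt0 muln_gt0 q_gt0 andbT orbb.
  by rewrite mulr0n; case: andP => // -[_ /jl].
rewrite !big_ord_recl big_ord0 addr0 ![row _ _ _ _]mxE !row_mxEr !mxE /=.
rewrite -addrA mulrnDl.
congr (_ + _); rewrite mulrnDl; congr (_ + _).
  have [->|jl_neq] := eqVneq j l.
    by case: (_ == K); rewrite ?expr1n ?mulr1 // mul0r.
  rewrite mulr0n; case: (eqVneq j.+1 K) => [jK|]; last by rewrite mul0r.
  case: (eqVneq l.+1 K) => [lK|_]; last by rewrite expr0n gtn_eqF ?mulr0.
  by case/eqP: jl_neq; apply: val_inj; apply: succn_inj; rewrite jK lK.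
have [->|jl_neq] := eqVneq j l.
  by case: (b && _); rewrite ?expr1n ?mulr1 // mul0r.
rewrite mulr0n; case: (eqVneq (j : nat) 0%N) => [j0|]; last first.
  by rewrite andbF mul0r.
case: (eqVneq (l : nat) 0%N) => [l0|_]; last first.
  by rewrite andbF expr0n gtn_eqF ?mulr0.
by case/eqP: jl_neq; apply: val_inj; rewrite /= j0 l0.
Qed.

(** Every row contributes exactly 1 to the left side. The first has diagonal entry [b], as delta_0 =
    0; the last has delta + 1, equal to 1 or 2 and hence nonzero, and the divisibility term counts
    it when [Delta] does not. K > 1 keeps these two rows apart. *)
Lemma dim_hull_extended_grs (F : finFieldType) (q n K : nat)
    (alpha v : 'I_n -> F) (b : bool) :
  [pchar F].-nat q -> odd n -> (1 < K <= n)%N ->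
  roots_and_zero alpha -> norm_roots q alpha v ->
  (forall j l, j < K -> l < K -> n.-1 %| j + l * q -> j = l)%N ->
  (\dim (herm_hull q (rowspace (extended_grs K alpha v b)))
   + #|Delta q alpha v K| + ~~ (n.-1 %| K.-1 * q.+1) + b = K)%N.
Proof.
move=> q_nat n_odd /andP[K_gt1 K_le] alphaP vP offdiag.
have n_gt1 : (1 < n)%N by exact: leq_trans K_le.
have q_gt0 : (0 < q)%N by case/andP: q_nat.
have [alpha_inj _ _] := alphaP.
have two_neq0 := natr2_neq0 n_odd n_gt1 alphaP.
have K_gt0 : (0 < K)%N by exact: ltnW.
have last_lt : (K.-1 < K)%N by rewrite prednK.
pose o := Ordinal K_gt0; pose w := Ordinal last_lt.
pose d (j : 'I_K) :=
  delta q alpha v j + (j.+1 == K)%:R + (b && (j == 0 :> nat)%N)%:R.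
rewrite (@dim_hull_orthogonal_rows _ _ _ _ _ d) //; last first.
- move=> j l; apply: extended_grs_gram => // dv.
  by apply: val_inj; apply: offdiag dv; exact: ltn_ord.
- apply: row_free_extended_grs => // [|i]; last by case: (vP i).
  by rewrite K_gt0 addn2 !ltnS ltnW.
have card_sum (P : pred 'I_K) : #|[set j | P j]| = (\sum_j P j)%N.
  by rewrite -sum1dep_card big_mkcond; apply: eq_bigr => j _; case: (P j).
rewrite /Delta !card_sum -big_split /= -[RHS]card_ord -sum1_card.
(* Both correction terms become sums over all rows, supported at [w] and [o], so that the identity
   can be checked row by row. *)
have -> : (~~ (n.-1 %| K.-1 * q.+1) =
    \sum_(j < K) (j == w) * ~~ (n.-1 %| j * q.+1) :> nat)%N.
  by rewrite (bigD1 w) // eqxx big1 /= ?mul1n ?addn0 // => j /negPf->.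
have -> : (b = \sum_(j < K) (j == o) * b :> nat)%N.
  by rewrite (bigD1 o) // eqxx big1 /= ?mul1n ?addn0 // => j /negPf->.
rewrite -!big_split /=; apply: eq_bigr => j _.
rewrite /d deltaE // -[(j == 0 :> nat)%N]/(j == o).
have -> : (j.+1 == K) = (j == w) by rewrite -[RHS]eqSS /= prednK.
have [->|jo] := eqVneq j o.
  have -> : (o == w) = false.
    by apply/eqP => /(congr1 val) /=; move: K_gt1; clear; lia.
  by rewrite /= !add0r andbT eqxx; case: b {d}; rewrite ?oner_eq0 ?eqxx.
have -> : (0 < j)%N by rewrite lt0n.
rewrite andbF addr0 /=; case: (j == w); case: (_ %| _)%N => /=;
  by rewrite ?(addr0, add0r) -?natrD ?oner_eq0 ?eqxx ?(negPf two_neq0).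
Qed.

(* The case q = n = 3, K = 1, where the extended code is not self-orthogonal. *)
Lemma self_orthogonal_line (F : finFieldType) (w : F) :
  w ^+ 4 = -1 ->
  exists C : {vspace 'rV[F]_(3 + 2)},
    code_params C 1 4 /\ \dim (herm_hull 3 C) = 1%N.
Proof.
move=> w4; have w0 : w != 0.
  by apply: contra_eq_neq w4 => ->; rewrite expr0n eq_sym oppr_eq0 oner_eq0.
(* The norm is 2 + 2 w^4 = 0, and the weight is 4 = n + 2 - K. *)
pose x : 'rV[F]_(3 + 2) := \row_i [:: 1; 1; w; w; 0]`_i.
have hdist_x k : k != 0 -> hdist (k *: x) 0 = 4.
  move=> k0; rewrite /hdist -sum1dep_card big_mkcond !big_ord_recl big_ord0.
  by rewrite !mxE /= !mulf_eq0 !(negPf k0) (negPf w0) oner_eq0 eqxx.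
have x0 : x != 0.
  by apply/eqP => /rowP/(_ ord0); rewrite !mxE /=; apply/eqP; exact: oner_neq0.
have x_orth k : herm 3 x (k *: x) = 0.
  rewrite /herm !big_ord_recl big_ord0 !mxE /=.
  by transitivity (k ^+ 3 * (2%:R + 2%:R * w ^+ 4)); [ring|rewrite w4; ring].
exists <[x]>%VS; split; [split|].
- by rewrite dim_vline x0.
- apply: (@min_distance_linear _ _ _ _ x); rewrite ?memv_line //.
    by rewrite -[x]scale1r hdist_x ?oner_neq0.
  move=> _ /vlineP[k ->]; rewrite scaler_eq0 negb_or => /andP[k0 _].
  by rewrite hdist_x.
have -> : herm_hull 3 <[x]> = <[x]>%VS.
  apply/capv_idPl; rewrite -memvE; apply/mem_herm_dual => _ /vlineP[k ->].
  exact: x_orth.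
by rewrite dim_vline x0.
Qed.

(** * The exceptional length and the four divisibility cases *)

Theorem theorem5 (p e q n k K : nat) (imin : int) (F : finFieldType)
    (alpha v : 'I_n -> F)
    (p_prime : prime p) (e_gt0 : (0 < e)%N) (q_def : q = (p ^ e)%N)
    (cardF : #|F| = (q ^ 2)%N)
    (n_odd : odd n) (n_dvd : (n - 1 %| q ^ 2 - 1)%N)
    (k_def : k = ((n + q - 1) %/ (q + 1))%N)
    (imin_def : imin = Num.min (((n%:Z - q%:Z) %/ 2)%Z - k%:Z) (q%:Z - 1))
    (K_def : K%:Z = k%:Z + imin + 1) (K_gt0 : (0 < K)%N)
    (k_dvd : (n - 1 %| k * (q + 1))%N)
    (alphaP : roots_and_zero alpha) (vP : norm_roots q alpha v) :
  [/\ ~~ (n%:Z - 1 %| (K%:Z - 1) * (q%:Z + 1))%Z ->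
      ~~ (n%:Z - 1 %| (K%:Z - 2) * (q%:Z + 1))%Z ->
      exists C : {vspace 'rV[F]_(n + 2)}, code_params C K (n + 2 - K) /\
        (\dim (herm_hull q C))%:Z = K%:Z - #|Delta q alpha v K|%:Z - 2,
      ~~ (n%:Z - 1 %| (K%:Z - 1) * (q%:Z + 1))%Z ->
      (n%:Z - 1 %| (K%:Z - 2) * (q%:Z + 1))%Z ->
      exists C : {vspace 'rV[F]_(n + 2)}, code_params C K (n + 2 - K) /\
        (\dim (herm_hull q C))%:Z = K%:Z - #|Delta q alpha v K|%:Z - 1,
      (n%:Z - 1 %| (K%:Z - 1) * (q%:Z + 1))%Z ->
      ~~ (n%:Z - 1 %| (K%:Z - 2) * (q%:Z + 1))%Z ->
      exists C : {vspace 'rV[F]_(n + 2)}, code_params C K (n + 2 - K) /\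
        (\dim (herm_hull q C))%:Z = K%:Z - #|Delta q alpha v K|%:Z - 1
    & (n%:Z - 1 %| (K%:Z - 1) * (q%:Z + 1))%Z ->
      (n%:Z - 1 %| (K%:Z - 2) * (q%:Z + 1))%Z ->
      exists C : {vspace 'rV[F]_(n + 2)}, code_params C K (n + 2 - K) /\
        (\dim (herm_hull q C))%:Z = K%:Z - #|Delta q alpha v K|%:Z].
Proof.
have q_gt1 : (1 < q)%N by rewrite q_def -(exp1n e) ltn_exp2r // prime_gt1.
have q_nat : [pchar F].-nat q.
  have pF : p \in [pchar F].
    by apply: (@card_finPcharP _ _ (e * 2)); rewrite // expnM -q_def.
  by rewrite (eq_pnat _ (pcharf_eq pF)) q_def pnatX pnat_id.
have [[qE nE KE]|[nE k_dvd_q /andP[K_gt1]]] :=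
    length_cases n_odd n_dvd q_gt1 k_def imin_def K_def K_gt0 k_dvd.
  clear q_def k_def; subst q n K.
  have -> : #|Delta 3 alpha v 1| = 0%N.
    by apply: eq_card0 => j; rewrite inE ord1 deltaE ?eqxx.
  (* Both 0 and -4 are divisible by n - 1 = 2, so only the fourth case survives. *)
  split=> //.
  (* The multiplier at the point 0 serves, the Lagrange weight there being -1. *)
  have [w w4] : exists w : F, w ^+ 4 = -1.
    have [_ _ alpha0] := alphaP; exists (v ord_max); rewrite (vP ord_max).2.
    by rewrite lagrange_weightE // alpha0 // expr0n mulr0 sub0r invrN invr1.
  have [C [C_params C_hull]] := self_orthogonal_line w4.
  by exists C; rewrite C_hull.
rewrite leq_min => /andP[K_le K_le'].
(* The second column is switched on in the first and third cases, where one further dimension must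
   leave the hull. *)
pose b := ~~ (n%:Z - 1 %| (K%:Z - 2) * (q%:Z + 1))%Z.
have offdiag j l : (j < K -> l < K -> n.-1 %| j + l * q -> j = l)%N.
  move=> jK lK; rewrite -subn1 nE; apply: gram_offdiag => //.
    exact: leq_trans K_le'.
  exact: leq_trans K_le'.
have dvdE : (n%:Z - 1 %| (K%:Z - 1) * (q%:Z + 1))%Z = (n.-1 %| K.-1 * q.+1)%N.
  have n_gt0 : (0 < n)%N by case: (n) n_odd.
  by rewrite -!predn_int // [q%:Z + 1]addrC -intS -PoszM dvdzE.
have K_range : (1 < K <= n)%N by rewrite K_gt1.
have C_params := extended_grs_params b K_range alphaP (fun i => (vP i).1).
have C_hull := dim_hull_extended_grs b q_nat n_odd K_range alphaP vP offdiag.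
rewrite dvdE; split=> d1 d2;
  (exists (rowspace (extended_grs K alpha v b)); split=> //);
  by move: C_hull; rewrite /b ?d1 ?d2 ?(negPf d1) ?(negPf d2) /=; clear; lia.
Qed.
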